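(* Among the twelve theta constants $\theta[\tfrac j5;\tfrac k5]$ and $\theta[1;\tfrac j5]$, where $j\in\{1,3\}$ and $k\in\{1,3,5,7,9\}$, there exist at most five which are algebraically independent over $\mathbb{C}$.
   Context: Let $\mathbb{H}^2=\{\tau\in\mathbb{C}:\Im\tau>0\}$. For $(\epsilon,\epsilon')\in\mathbb{R}^2$, $$\theta[\epsilon;\epsilon'](\zeta,\tau)=\sum_{n\in\mathbb{Z}}\exp\Big(2\pi i\Big[\tfrac12\big(n+\tfrac{\epsilon}{2}\big)^2\tau+\big(n+\tfrac{\epsilon}{2}\big)\big(\zeta+\tfrac{\epsilon'}{2}\big)\Big]\Big),$$ and the theta constant $\theta[\epsilon;\epsilon']=\theta[\epsilon;\epsilon'](0,\tau)$ is regarded as a holomorphic function of $\tau\in\mathbb{H}^2$; algebraic independence is as elements of the field of meromorphic functions on $\mathbb{H}^2$. *)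

(* Defs.v *)
From HB Require Import structures.
From mathcomp Require Import all_boot all_order all_algebra.
From mathcomp Require Import mpoly.
From mathcomp Require Import all_classical all_reals all_analysis.
From mathcomp Require Import complex.
Set Implicit Arguments. Unset Strict Implicit. Unset Printing Implicit Defensive.
Import Order.TTheory GRing.Theory Num.Theory.
Import numFieldNormedType.Exports.
Local Open Scope ring_scope.
Local Open Scope complex_scope.

Section Theta.
Variable R : realType.

Definition cexp (z : R[i]) : R[i] :=
  (expR (complex.Re z))%:C * (cos (complex.Im z) +i* sin (complex.Im z)).

(* Sum over n in Z of f n, defined as the limit of the symmetric partial
   sums \sum_{n=-N}^{N} f n (taken componentwise on real/imaginary parts). *)
Definition zpartial (f : int -> R[i]) (N : nat) : R[i] :=
  \sum_(i < (N.*2).+1) f (i%:Z - N%:Z)%R.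

Definition zsum (f : int -> R[i]) : R[i] :=
  (limn (fun N : nat => (complex.Re (zpartial f N) : R))) +i* (limn (fun N : nat => (complex.Im (zpartial f N) : R))).

Definition theta_fun (eps eps' : R) (zeta tau : R[i]) : R[i] :=
  zsum (fun n : int =>
    let m : R[i] := (n%:~R + eps / 2)%:C in
    cexp (2%:R * pi%:C * 'i *
          ((1/2)%:C * m ^+ 2 * tau + m * (zeta + (eps' / 2)%:C)))).

Definition theta_const (eps eps' : R) (tau : R[i]) : R[i] :=
  theta_fun eps eps' 0 tau.

Definition upper_half_plane (tau : R[i]) : Prop := 0 < complex.Im tau.

Definition twelve_char (eps eps' : R) : Prop :=
  (exists j k : nat, j \in [:: 1; 3]%N /\ k \in [:: 1; 3; 5; 7; 9]%N /\
      eps = j%:R / 5%:R /\ eps' = k%:R / 5%:R)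
  \/ (exists j : nat, j \in [:: 1; 3]%N /\ eps = 1 /\ eps' = j%:R / 5%:R).

Definition alg_dependent_on_H (n : nat) (f : 'I_n -> R[i] -> R[i]) : Prop :=
  exists P : mpoly.mpoly n R[i], P != 0 /\
    forall tau : R[i], upper_half_plane tau ->
      mpoly.meval (fun i => f i tau) P = 0.

End Theta.

(* Main.v *)
(* For the characteristics at hand the twelve theta constants are the values of
   the odd theta function at the nonzero 5-torsion points modulo sign, up to
   roots of unity. Reindexing the double series along (m + n, m - n) gives
   theta(x + y) theta(x - y) = e(x) (A(x) B(y) - B(x) A(y)), where A and B are
   theta series in 2 tau, so the Pluecker relation yields quartic three-term
   relations between the twelve constants. For suitable weights, the twelve
   variables fall into five classes such that every product x ^ 3 y ^ 3 of
   distinct variables of one class reduces to monomials of smaller weight and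
   the same degree. Hence monomials of degree less than E are spanned by those
   with at most one exponent >= 3 in each class, of which there are O(E ^ 5),
   whereas the monomials in six of the constants grow like E ^ 6. *)

Require Import Defs.
From HB Require Import structures.
From mathcomp Require Import all_boot all_order all_algebra.
From mathcomp Require Import mpoly.
From mathcomp Require Import all_classical all_reals all_analysis.
From mathcomp Require Import complex.
From mathcomp Require Import ring lra zify.
Set Implicit Arguments. Unset Strict Implicit. Unset Printing Implicit Defensive.
Import Order.TTheory GRing.Theory Num.Theory.
Import numFieldNormedType.Exports.
Local Open Scope ring_scope.

(** * Standard monomials and the dimension count *)

Section StandardMonomials.
Variables (K : fieldType) (T : Type) (n m : nat) (g : 'I_n -> T -> K).

Definition monom_eval (e : 'X_{1..n}) (t : T) : K := \prod_i g i t ^+ e i.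

Lemma monom_evalD e f t :
  monom_eval (e + f)%MM t = monom_eval e t * monom_eval f t.
Proof.
by rewrite -big_split; apply: eq_bigr => i _; rewrite mnmDE exprD.
Qed.

Lemma monom_eval0 t : monom_eval 0%MM t = 1.
Proof. by rewrite /monom_eval big1 // => i _; rewrite mnm0E expr0. Qed.

Lemma monom_evalU i t : monom_eval U_(i)%MM t = g i t.
Proof.
rewrite /monom_eval (bigD1 i) //= mnm1E eqxx expr1 big1 ?mulr1 // => j ji.
by rewrite mnm1E eq_sym (negbTE ji) expr0.
Qed.

Lemma monom_evalMn e k t : monom_eval (e *+ k)%MM t = monom_eval e t ^+ k.
Proof.
rewrite /monom_eval -prodrXl; apply: eq_bigr => i _.
by rewrite mulmnE exprM.
Qed.

Lemma monom_eval_sum (I : finType) (F : I -> 'X_{1..n}) t :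
  monom_eval (\sum_i F i)%MM t = \prod_i monom_eval (F i) t.
Proof.
apply: (big_morph (fun e => monom_eval e t)) => [e f|].
  exact: monom_evalD.
exact: monom_eval0.
Qed.

Variables (cl : 'I_n -> 'I_m) (wt : 'I_n -> nat) (b : nat).

Definition mweight (e : 'X_{1..n}) : nat := (\sum_i e i * wt i)%N.

Lemma mweightD e f : mweight (e + f)%MM = (mweight e + mweight f)%N.
Proof.
by rewrite -big_split; apply: eq_bigr => i _; rewrite mnmDE mulnDl.
Qed.

Lemma mweightU i : mweight U_(i)%MM = wt i.
Proof.
rewrite /mweight (bigD1 i) //= mnm1E eqxx mul1n big1 ?addn0 // => j ji.
by rewrite mnm1E eq_sym (negbTE ji).
Qed.

(** Two terms on the right match a three-term relation. Equal degree keeps rewriting inside a fixed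
    degree range, and smaller weight makes it terminate. *)
Definition reducible (e : 'X_{1..n}) : Prop :=
  exists c d : K, exists u v : 'X_{1..n},
    [/\ mdeg u = mdeg e, mdeg v = mdeg e,
        (mweight u < mweight e)%N, (mweight v < mweight e)%N &
        forall t, monom_eval e t = c * monom_eval u t + d * monom_eval v t].

Lemma reducibleD e f : reducible e -> reducible (e + f)%MM.
Proof.
move=> [c [d [u [v [du dv wu wv H]]]]].
exists c, d, (u + f)%MM, (v + f)%MM; split.
- by rewrite !mdegD du.
- by rewrite !mdegD dv.
- by rewrite !mweightD ltn_add2r.
- by rewrite !mweightD ltn_add2r.
- by move=> t; rewrite !monom_evalD H; ring.
Qed.

(* A code records, for each class, at most one variable with its excess over b,
   and for every variable an exponent at most b. *)
Definition code (E : nat) : finType :=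
  ({ffun 'I_m -> option 'I_n} * {ffun 'I_m -> 'I_E} * {ffun 'I_n -> 'I_b.+1})%type.

Definition decode E (x : code E) : 'X_{1..n} :=
  [multinom [tuple (x.2 i + \sum_k (x.1.1 k == Some i) * x.1.2 k)%N | i < n]].

Definition standard (e : 'X_{1..n}) : bool :=
  [forall i : 'I_n, forall j : 'I_n,
    (i < j)%N ==> (cl i == cl j) ==> ~~ ((b <= e i) && (b <= e j))%N].

(** Each exponent splits as [minn (e i) b] plus an excess over [b]. Standardness lets at most one
    variable per class have exponent at least [b], so one excess per class is enough. *)
Lemma standard_decode E (e : 'X_{1..n}) :
  (mdeg e < E)%N -> standard e -> exists x : code E, e = decode x.
Proof.
case: E => // E dE st.
have big_uniq i j : cl i = cl j -> (b <= e i)%N -> (b <= e j)%N -> i = j.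
  wlog ij : i j / (i < j)%N.
    move=> W; case: (ltngtP i j) => [||/val_inj //]; first exact: W.
    by move=> ? cij *; apply/esym/W.
  move=> cij bi bj; move: st => /forallP/(_ i)/forallP/(_ j).
  by rewrite ij cij eqxx bi bj.
have le_deg i : (e i <= mdeg e)%N by rewrite mdegE (bigD1 i) //= leq_addr.
pose p k := [pick i | (cl i == k) && (b <= e i)%N].
(* In a class without large exponent the value 0 is a dummy: [decode] ignores it, since [p k] is
   [None]. *)
pose B k := if p k is Some i then (e i - b)%N else 0%N.
have BE k : (B k < E.+1)%N.
  rewrite /B; case: (p k) => // i.
  by rewrite (leq_ltn_trans (leq_subr _ _)) // (leq_ltn_trans (le_deg i)).
pose s i := minn (e i) b.
have sb i : (s i < b.+1)%N by rewrite ltnS geq_minr.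
exists ([ffun k => p k], [ffun k => Ordinal (BE k)], [ffun i => Ordinal (sb i)]).
apply/mnmP => i; rewrite mnmE /= ffunE /= /s.
under eq_bigr do rewrite !ffunE /=.
have [bi|ib] := leqP b (e i).
  have pi : p (cl i) = Some i.
    rewrite /p; case: pickP => [j /andP[/eqP cj bj]|/(_ i)]; last by rewrite eqxx bi.
    by congr Some; apply: big_uniq.
  rewrite (bigD1 (cl i)) //= {1}pi eqxx mul1n /B pi big1 ?addn0 ?subnKC //.
  move=> k ki; case: eqP => [|//]; rewrite /p; case: pickP => // j /andP[/eqP cj _] [ji].
  by move: ki; rewrite -cj ji eqxx.
rewrite big1 ?addn0 // => k _; case: eqP => [|//]; rewrite {1}/p.
by case: pickP => // j /andP[_ bj] [ji]; rewrite ji leqNgt ib in bj.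
Qed.

Hypothesis class_reducible : forall i j : 'I_n, (i < j)%N -> cl i = cl j ->
  reducible (U_(i) *+ b + U_(j) *+ b)%MM.

(** Strong induction on the weight: a nonstandard monomial is divisible by some [x ^ b * y ^ b] with
    [x], [y] in one class, hence reduces to two lighter monomials of the same degree. *)
Lemma standard_span E (e : 'X_{1..n}) : (mdeg e < E)%N ->
  exists c : code E -> K,
    forall t, monom_eval e t = \sum_x c x * monom_eval (decode x) t.
Proof.
have [N] := ubnP (mweight e); elim: N e => // N IH e; rewrite ltnS => wN dE.
case: (boolP (standard e)) => [st|].
  have [x ->] := standard_decode dE st.
  exists (fun y => (y == x)%:R) => t.
  rewrite (bigD1 x) //= eqxx mul1r big1 ?addr0 // => y /negbTE->.
  by rewrite mul0r.
move=> /forallPn[ i] /forallPn[j].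
rewrite 2!negb_imply negbK => /and3P[ij /eqP cij /andP[bi bj]].
have ne_ij : (i == j) = false by apply/negbTE; rewrite neq_ltn ij.
set f := (U_(i) *+ b + U_(j) *+ b)%MM.
have fe : (f <= e)%MM.
  apply/mnm_lepP => k; rewrite mnmDE !mulmnE !mnm1E.
  have [<-|_] := eqVneq i k; first by rewrite eq_sym ne_ij !mul1n mul0n addn0.
  by have [<-|_] := eqVneq j k; rewrite ?mul1n.
have : reducible (f + (e - f))%MM by apply/reducibleD/class_reducible.
rewrite addmC submK // => -[c [d [u [v [du dv wu wv H]]]]].
have [cu Hu] : exists c : code E -> K,
    forall t, monom_eval u t = \sum_x c x * monom_eval (decode x) t.
  by apply: IH; [apply: leq_trans wN|rewrite du].
have [cv Hv] : exists c : code E -> K,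
    forall t, monom_eval v t = \sum_x c x * monom_eval (decode x) t.
  by apply: IH; [apply: leq_trans wN|rewrite dv].
exists (fun x => c * cu x + d * cv x) => t; rewrite H Hu Hv !mulr_sumr -big_split.
by apply: eq_bigr => x _ /=; ring.
Qed.

(** For E = (m + 1) D the number of codes is C D ^ m with C independent of D, so D = C + 1
    suffices. *)
Lemma card_code_lt : exists2 D, (0 < D)%N & (#|{: code (m.+1 * D)}| < D ^ m.+1)%N.
Proof.
pose C := (n.+1 ^ m * m.+1 ^ m * b.+1 ^ n)%N.
exists C.+1 => //.
rewrite !card_prod !card_ffun card_option !card_ord expnMn.
have -> : (n.+1 ^ m * (m.+1 ^ m * C.+1 ^ m) * b.+1 ^ n = C * C.+1 ^ m)%N.
  by rewrite /C; ring.
by rewrite expnS ltn_pmul2r ?expn_gt0.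
Qed.

(** The D ^ (m + 1) monomials with exponents below D in the chosen functions lie in the span of
    fewer decoded monomials. A nonzero row of the left kernel of the coefficient matrix gives the
    coefficients of [P]. *)
Theorem algebraic_dependence (s : 'I_m.+1 -> 'I_n) :
  exists2 P : {mpoly K[m.+1]}, P != 0 & forall t, P.@[fun i => g (s i) t] = 0.
Proof.
have [D D_gt0 ltD] := card_code_lt.
pose A : finType := {ffun 'I_m.+1 -> 'I_D}.
have cardA : #|A| = (D ^ m.+1)%N by rewrite card_ffun !card_ord.
pose ea (a : A) : 'X_{1..n} := (\sum_i U_(s i) *+ a i)%MM.
pose xa (a : A) : 'X_{1..m.+1} := [multinom [tuple (a i : nat) | i < m.+1]].
have span a : exists c : code (m.+1 * D) -> K,
    forall t, monom_eval (ea a) t = \sum_x c x * monom_eval (decode x) t.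
  apply: standard_span; rewrite mdeg_sum.
  under eq_bigr do rewrite mdegMn mdeg1 mul1n.
  (* Splitting off the first exponent, which is strictly below [D], makes the degree bound
     strict. *)
  rewrite big_ord_recl mulSn -addSn leq_add // -[X in (_ <= X * _)%N]card_ord.
  by rewrite -sum_nat_const; apply: leq_sum => k _; apply: ltnW.
have [c Hc] := fin_all_exists span.
pose M : 'M[K]_(#|A|, #|{: code (m.+1 * D)}|) :=
  \matrix_(i, j) c (enum_val i) (enum_val j).
have : kermx M != 0.
  rewrite kermx_eq0 /row_free neq_ltn (leq_ltn_trans (rank_leq_col _)) //.
  by rewrite cardA.
case/matrix0Pn => i [j kij].
pose w a := kermx M i (enum_rank a).
exists (\sum_a w a *: 'X_[xa a]).
  (* The exponent vectors [xa a] are pairwise distinct, so the coefficient at [xa (enum_val j)] is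
     the nonzero kernel entry; this remains true if [s] repeats an index. *)
  apply/eqP => /(congr1 (mcoeff (xa (enum_val j)))).
  rewrite mcoeff0 raddf_sum /= (bigD1 (enum_val j)) //= big1 => [|a aj].
    rewrite mcoeffZ mcoeffX eqxx mulr1 addr0 /w enum_valK => /eqP.
    by rewrite (negbTE kij).
  rewrite mcoeffZ mcoeffX; case: eqP => [xaj|_]; last by rewrite mulr0.
  case/eqP: aj; apply/ffunP => k; apply: val_inj.
  by have := congr1 (fun e : 'X_{1..m.+1} => e k) xaj; rewrite !mnmE.
move=> t; rewrite raddf_sum /=.
transitivity (\sum_a w a * monom_eval (ea a) t).
  apply: eq_bigr => a _; rewrite mevalZ mevalX monom_eval_sum; congr (_ * _).
  by apply: eq_bigr => k _; rewrite mnmE monom_evalMn monom_evalU.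
under eq_bigr do rewrite Hc mulr_sumr.
rewrite exchange_big big1 //= => x _.
under eq_bigr do rewrite mulrA.
rewrite -mulr_suml.
suff -> : \sum_a w a * c a x = 0 by rewrite mul0r.
have /matrixP/(_ i (enum_rank x)) := mulmx_ker M.
rewrite !mxE => {2}<-; rewrite (reindex (fun k : 'I_#|A| => enum_val k)) /=; last first.
  by apply: onW_bij; apply: enum_val_bij.
by apply: eq_bigr => k _; rewrite /w enum_valK !mxE enum_rankK.
Qed.

End StandardMonomials.

(** * Absolutely convergent sums over the integers and their rearrangement *)

Section SymmetricSums.
Variable R : realType.
Local Notation normc := (@ComplexField.Normc.normc R).

Lemma normr_Re_le (z : R[i]) : `|complex.Re z| <= normc z.
Proof.
by case: z => a b /=; rewrite -sqrtr_sqr ler_wsqrtr // lerDl sqr_ge0.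
Qed.

Lemma normr_Im_le (z : R[i]) : `|complex.Im z| <= normc z.
Proof.
by case: z => a b /=; rewrite -sqrtr_sqr ler_wsqrtr // lerDr sqr_ge0.
Qed.

Lemma normc_ge0 (z : R[i]) : 0 <= normc z.
Proof. by case: z => a b; apply: sqrtr_ge0. Qed.

Lemma normc_sum_le (I : Type) (s : seq I) (F : I -> R[i]) :
  normc (\sum_(x <- s) F x) <= \sum_(x <- s) normc (F x).
Proof.
elim/big_ind2: _ => [|x a y b ax by_|//]; first by rewrite ComplexField.Normc.normc0.
by apply: le_trans (lerD ax by_); apply: le_normcD.
Qed.

(** Componentwise, to agree with the limits that define [zsum]. *)
Definition ccvg (u : nat -> R[i]) (l : R[i]) : Prop :=
  ((fun N => complex.Re (u N)) @ \oo --> complex.Re l)%classic /\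
  ((fun N => complex.Im (u N)) @ \oo --> complex.Im l)%classic.

Lemma ccvg_unique u l l' : ccvg u l -> ccvg u l' -> l = l'.
Proof.
move=> [ul1 ul2] [ul1' ul2']; apply/eqP; rewrite eq_complex; apply/andP; split.
  by apply/eqP; apply: (cvg_unique _ ul1 ul1'); exact: norm_hausdorff.
by apply/eqP; apply: (cvg_unique _ ul2 ul2'); exact: norm_hausdorff.
Qed.

Lemma ccvgD u v l l' : ccvg u l -> ccvg v l' -> ccvg (fun N => u N + v N) (l + l').
Proof.
move=> [ul1 ul2] [vl1 vl2]; split.
  by rewrite raddfD; under eq_fun do rewrite raddfD; apply: cvgD.
by rewrite raddfD; under eq_fun do rewrite raddfD; apply: cvgD.
Qed.

Lemma ccvgM u v l l' : ccvg u l -> ccvg v l' -> ccvg (fun N => u N * v N) (l * l').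
Proof.
have ReM (x y : R[i]) : complex.Re (x * y) =
    complex.Re x * complex.Re y - complex.Im x * complex.Im y.
  by case: x y => [? ?] [].
have ImM (x y : R[i]) : complex.Im (x * y) =
    complex.Re x * complex.Im y + complex.Im x * complex.Re y.
  by case: x y => [? ?] [].
move=> [ul1 ul2] [vl1 vl2]; split.
  by rewrite ReM; under eq_fun do rewrite ReM; apply: cvgB; apply: cvgM.
by rewrite ImM; under eq_fun do rewrite ImM; apply: cvgD; apply: cvgM.
Qed.

Lemma ccvg_cst c : ccvg (fun=> c) c.
Proof. by split; apply: cvg_cst. Qed.

Lemma ccvg0_le u (e : nat -> R) :
  (forall N, normc (u N) <= e N) -> (e @ \oo --> (0 : R))%classic -> ccvg u 0.
Proof.
move=> ue e0.
have sq (v : nat -> R) : (forall N, `|v N| <= e N) -> (v @ \oo --> (0 : R))%classic.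
  move=> ve; have Ne0 : ((fun N => - e N) @ \oo --> (0 : R))%classic.
    by rewrite -oppr0; apply: cvgN.
  apply: squeeze_cvgr Ne0 e0; apply: nearW => N.
  by rewrite -ler_norml.
by split; apply: sq => N; apply: le_trans (ue N);
  [apply: normr_Re_le | apply: normr_Im_le].
Qed.

Definition zrange (N : nat) : seq int := [seq i%:Z - N%:Z | i <- iota 0 N.*2.+1].

Lemma mem_zrange N (n : int) : (n \in zrange N) = (`|n| <= N)%N.
Proof.
apply/mapP/idP => [[k] | nN].
  by rewrite mem_iota => /andP[_ kN] ->; lia.
exists (absz (n + N%:Z)); last by lia.
by rewrite mem_iota; lia.
Qed.

Lemma zrange_uniq N : uniq (zrange N).
Proof. by rewrite map_inj_uniq ?iota_uniq // => i j; lia. Qed.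

Lemma zpartialE (f : int -> R[i]) N : zpartial f N = \sum_(n <- zrange N) f n.
Proof.
by rewrite /zpartial -(big_mkord xpredT (fun i : nat => f (i%:Z - N%:Z))) big_map
  /index_iota subn0.
Qed.

Lemma big_zrangeS (V : nmodType) (f : int -> V) N :
  \sum_(n <- zrange N.+1) f n =
  \sum_(n <- zrange N) f n + (f N.+1%:Z + f (- N.+1%:Z)).
Proof.
have /(perm_big _) -> : perm_eq (zrange N.+1) (- N.+1%:Z :: N.+1%:Z :: zrange N).
  apply: uniq_perm; first exact: zrange_uniq.
    by rewrite 2!cons_uniq zrange_uniq in_cons !mem_zrange; lia.
  by move=> n; rewrite (in_cons (- N.+1%:Z)) (in_cons N.+1%:Z) !mem_zrange; lia.
rewrite (big_cons _ _ (- N.+1%:Z)) (big_cons _ _ N.+1%:Z).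
by rewrite [RHS]addrC [X in _ = X + _]addrC -addrA.
Qed.

Definition geom_dominated (V : Type) (norm : V -> R) (f : int -> V) : Prop :=
  exists C q : R, [/\ 0 <= q, q < 1 & forall n, norm (f n) <= C * q ^+ `|n|%N].

(** Pairing the terms at k + 1 and -(k + 1) turns the symmetric sums into an ordinary series with a
    geometric majorant. *)
Lemma is_cvg_zrange_sum (f : int -> R) : geom_dominated (fun x => `|x|) f ->
  cvgn (fun N => \sum_(n <- zrange N) f n).
Proof.
move=> [C [q [q0 q1 fq]]].
have C0 : 0 <= C by have := le_trans (normr_ge0 _) (fq 0); rewrite expr0 mulr1.
pose h k : R := f k.+1%:Z + f (- k.+1%:Z).
have -> : (fun N => \sum_(n <- zrange N) f n) = (fun N => f 0 + series h N).
  apply/funext => N; elim: N => [|N IH].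
    by rewrite /zrange big_seq1 subr0 /series /= big_geq // addr0.
  by rewrite big_zrangeS IH -addrA seriesSr.
apply: is_cvgD; first exact: is_cvg_cst.
apply: normed_cvg; apply: (@series_le_cvg _ _ (geometric (2 * C * q) q)) => //.
- by move=> k; apply: normr_ge0.
- by move=> k; apply: mulr_ge0; [do 2!apply: mulr_ge0 => // | apply: exprn_ge0].
- move=> k; rewrite /= (le_trans (ler_normD _ _)) //.
  apply: le_trans (lerD (fq _) (fq _)) _.
  rewrite absz_nat abszN absz_nat exprS le_eqVlt; apply/orP; left; apply/eqP; ring.
- by apply: is_cvg_geometric_series; rewrite ger0_norm.
Qed.

Lemma zsum_ccvg (f : int -> R[i]) : geom_dominated normc f ->
  ccvg (zpartial f) (zsum f).
Proof.
move=> [C [q [q0 q1 fq]]]; split => /=.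
  have -> : (fun N => complex.Re (zpartial f N)) =
     (fun N => \sum_(n <- zrange N) complex.Re (f n)).
    by apply/funext => N; rewrite zpartialE raddf_sum.
  apply: is_cvg_zrange_sum; exists C, q; split => // n.
  exact: le_trans (normr_Re_le _) (fq n).
have -> : (fun N => complex.Im (zpartial f N)) =
   (fun N => \sum_(n <- zrange N) complex.Im (f n)).
  by apply/funext => N; rewrite zpartialE raddf_sum.
apply: is_cvg_zrange_sum; exists C, q; split => // n.
exact: le_trans (normr_Im_le _) (fq n).
Qed.

Lemma big_seq_subset (T : eqType) (V : nmodType) (s t : seq T) (F : T -> V) :
  uniq s -> uniq t -> {subset s <= t} ->
  \sum_(x <- t) F x = \sum_(x <- s) F x + \sum_(x <- t | x \notin s) F x.
Proof.
move=> us ut st; rewrite (bigID (mem s)) /=; congr (_ + _).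
rewrite -big_filter; apply: perm_big; apply: uniq_perm => //.
  exact: filter_uniq.
by move=> x; rewrite mem_filter; case: (boolP (x \in s)) => //= /st.
Qed.

(** The difference is a sum over the part of [t] outside [s], whose absolute sum grows when [t] is
    enlarged to [u]. This will compare sums over an awkward index set lying between two boxes. *)
Lemma normc_sum_subset (T : eqType) (s t u : seq T) (F : T -> R[i]) :
  uniq s -> uniq t -> uniq u -> {subset s <= t} -> {subset t <= u} ->
  normc (\sum_(x <- t) F x - \sum_(x <- s) F x) <=
  \sum_(x <- u) normc (F x) - \sum_(x <- s) normc (F x).
Proof.
move=> us ut uu st tu.
rewrite (big_seq_subset F us ut st) addrAC subrr add0r -big_filter.
apply: le_trans (normc_sum_le _ _) _.
rewrite big_filter lerBrDl -(big_seq_subset (fun x => normc (F x)) us ut st).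
rewrite (big_seq_subset (fun x => normc (F x)) ut uu tu) lerDl.
by apply: sumr_ge0 => x _; apply: normc_ge0.
Qed.

Definition zbox (N : nat) : seq (int * int) :=
  [seq (m, n) | m <- zrange N, n <- zrange N].

Lemma mem_zbox N (x : int * int) :
  (x \in zbox N) = (`|x.1| <= N)%N && (`|x.2| <= N)%N.
Proof.
case: x => m n; rewrite -!mem_zrange /zbox.
by apply/allpairsP/andP => [[[a b] /= [ma nb [-> ->]]] | [mN nN]] //; exists (m, n).
Qed.

Lemma zbox_uniq N : uniq (zbox N).
Proof. by apply: allpairs_uniq; rewrite ?zrange_uniq // => -[? ?] [? ?]. Qed.

Lemma zbox_sum (S : pzSemiRingType) (f g : int -> S) N :
  \sum_(x <- zbox N) f x.1 * g x.2 =
  (\sum_(n <- zrange N) f n) * (\sum_(n <- zrange N) g n).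
Proof. by rewrite big_allpairs /= big_distrlr. Qed.

(** The image of a box under the diagonal change of variables: the first list holds the pairs of
    even coordinate sum, the second those of odd sum. *)
Definition zdiag (N : nat) : seq (int * int) :=
  [seq (x.1 + x.2, x.1 - x.2) | x <- zbox N] ++
  [seq (x.1 + x.2 + 1, x.1 - x.2) | x <- zbox N].

Lemma zdiag_uniq N : uniq (zdiag N).
Proof.
rewrite cat_uniq; apply/and3P; split.
- rewrite map_inj_uniq ?zbox_uniq // => -[k l] [k' l'] [? ?]; congr pair; lia.
- apply/hasPn => _ /mapP[[k l] _ ->]; apply/negP => /mapP[[k' l'] _] [? ?]; lia.
- rewrite map_inj_uniq ?zbox_uniq // => -[k l] [k' l'] [? ?]; congr pair; lia.
Qed.

Lemma zbox_sub_zdiag N : {subset zbox N <= zdiag N}.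
Proof.
move=> [m n]; rewrite mem_zbox mem_cat => /andP[mN nN]; rewrite /= in mN nN.
have [k [l [mkl nkl] ] ] : exists k l : int,
    (m = k + l \/ m = k + l + 1) /\ n = k - l.
  (* Here k is the floor of (m + n) / 2 and l = k - n; the remainder modulo 2 selects the case. *)
  exists (divz (m + n) 2), (divz (m + n) 2 - n).
  by have := divz_eq (m + n) 2; have := modz_ge0 (m + n) (isT : 2 != 0 :> int);
     have := ltz_mod (m + n) (isT : 2 != 0 :> int); lia.
apply/orP; case: mkl => mkl; [left|right]; apply/mapP; exists (k, l).
all: rewrite ?mem_zbox //=; first [lia | congr pair; lia].
Qed.

Lemma zdiag_sub_zbox N : {subset zdiag N <= zbox N.*2.+1}.
Proof.
move=> x; rewrite mem_cat mem_zbox => /orP[] /mapP[[k l]]; rewrite mem_zbox /= => kl -> /=.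
all: lia.
Qed.

(* Rearrangement of an absolutely convergent double series along
   (m, n) = (k + l, k - l) or (k + l + 1, k - l), according to parity. *)
Lemma zsum_mul_diag (f g a b a' b' : int -> R[i]) :
  geom_dominated normc f -> geom_dominated normc g ->
  geom_dominated normc a -> geom_dominated normc b ->
  geom_dominated normc a' -> geom_dominated normc b' ->
  (forall k l, f (k + l) * g (k - l) = a k * b l) ->
  (forall k l, f (k + l + 1) * g (k - l) = a' k * b' l) ->
  zsum f * zsum g = zsum a * zsum b + zsum a' * zsum b'.
Proof.
move=> df dg da db da' db' H H'.
pose F (x : int * int) := f x.1 * g x.2.
(* The error [u] is bounded by the absolute sum over box 2N + 1 minus that over box N; both tend to
   [p * r], so the error vanishes in the limit. *)
pose u N := \sum_(x <- zdiag N) F x - \sum_(x <- zbox N) F x.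
have normdom h : geom_dominated normc h ->
    cvgn (fun N => \sum_(n <- zrange N) normc (h n)).
  move=> [C [q [q0 q1 hq]]]; apply: is_cvg_zrange_sum.
  by exists C, q; split => // n; rewrite ger0_norm ?normc_ge0.
have /cvg_ex[/= p cp] := normdom _ df; have /cvg_ex[/= r cr] := normdom _ dg.
have dbl : ((fun N => N.*2.+1) @ \oo --> \oo)%classic.
  by move=> A [k _ kA]; exists k => // j /= kj; apply: kA => /=; lia.
have u0 : ccvg u 0.
  pose e N := \sum_(x <- zbox N.*2.+1) normc (F x) - \sum_(x <- zbox N) normc (F x).
  apply: (@ccvg0_le _ e).
    move=> N; apply: normc_sum_subset; rewrite ?zbox_uniq ?zdiag_uniq //.
      exact: zbox_sub_zdiag.
    exact: zdiag_sub_zbox.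
  have normF N : \sum_(x <- zbox N) normc (F x) =
      (\sum_(n <- zrange N) normc (f n)) * (\sum_(n <- zrange N) normc (g n)).
    by rewrite -zbox_sum; apply: eq_bigr => x _; rewrite ComplexField.Normc.normcM.
  rewrite -(subrr (p * r)).
  have -> : e = fun N => (\sum_(n <- zrange N.*2.+1) normc (f n)) *
      (\sum_(n <- zrange N.*2.+1) normc (g n)) -
      (\sum_(n <- zrange N) normc (f n)) * (\sum_(n <- zrange N) normc (g n)).
    by apply/funext => N; rewrite /e !normF.
  apply: cvgB; apply: cvgM => //.
    exact: (cvg_comp _ _ dbl cp).
  exact: (cvg_comp _ _ dbl cr).
have := ccvgD (ccvgM (zsum_ccvg df) (zsum_ccvg dg)) u0.
have -> : (fun N => zpartial f N * zpartial g N + u N) =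
    (fun N => zpartial a N * zpartial b N + zpartial a' N * zpartial b' N).
  apply/funext => N; rewrite /u !zpartialE -!zbox_sum addrC subrK big_cat !big_map.
  by congr (_ + _); apply: eq_bigr => x _; rewrite /F /= ?H ?H'.
rewrite addr0 => lim; apply: ccvg_unique lim _.
by apply: ccvgD; apply: ccvgM; apply: zsum_ccvg.
Qed.

Lemma zsumZ c (f : int -> R[i]) : geom_dominated normc f ->
  zsum (fun n => c * f n) = c * zsum f.
Proof.
move=> df.
have dcf : geom_dominated normc (fun n => c * f n).
  have [C [q [q0 q1 fq]]] := df; exists (normc c * C), q; split => // n.
  by rewrite ComplexField.Normc.normcM -mulrA ler_wpM2l ?normc_ge0.
apply: ccvg_unique (zsum_ccvg dcf) _.
have := ccvgM (ccvg_cst c) (zsum_ccvg df).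
by congr ccvg; apply/funext => N; rewrite !zpartialE mulr_sumr.
Qed.

(** The symmetric ranges are stable under negation, so already the partial sums agree. *)
Lemma zsum_opp (f : int -> R[i]) : zsum (fun n => f (- n)) = zsum f.
Proof.
have E N : zpartial (fun n => f (- n)) N = zpartial f N.
  rewrite !zpartialE -(big_map -%R xpredT f); apply: perm_big; apply: uniq_perm.
  - by rewrite map_inj_uniq ?zrange_uniq //; apply: oppr_inj.
  - exact: zrange_uniq.
  - move=> n; rewrite mem_zrange -[in LHS](opprK n) mem_map; last exact: oppr_inj.
    by rewrite mem_zrange abszN.
by rewrite /zsum; under eq_fun do rewrite E;
  under [X in (_ +i* limn X)%C = _]eq_fun do rewrite E.
Qed.

(** Shifting the window changes the partial sum by f(N + 1) - f(-N), which tends to 0. *)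
Lemma zsum_shift (f : int -> R[i]) : geom_dominated normc f ->
  geom_dominated normc (fun n => f (n + 1)) -> zsum (fun n => f (n + 1)) = zsum f.
Proof.
move=> df ds; apply: ccvg_unique (zsum_ccvg ds) _.
pose u N := f N.+1%:Z - f (- N%:Z).
have [C [q [q0 q1 fq]]] := df.
have C0 : 0 <= C by have := le_trans (normc_ge0 _) (fq 0); rewrite expr0 mulr1.
have u0 : ccvg u 0.
  apply: (@ccvg0_le _ (fun N => 2 * C * q ^+ N)) => [N|].
    apply: le_trans (le_normcD _ _) _; rewrite normcN.
    apply: le_trans (lerD (fq _) (fq _)) _.
    rewrite absz_nat abszN absz_nat -mulrA mulr_natl mulr2n lerD2r.
    by rewrite ler_wpM2l // exprS ler_piMl ?exprn_ge0 // ltW.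
  rewrite -(mulr0 (2 * C)); apply: cvgM; first exact: cvg_cst.
  by apply: cvg_expr; rewrite ger0_norm.
have := ccvgD (zsum_ccvg df) u0; rewrite addr0.
congr ccvg; apply/funext => N; rewrite /u !zpartialE.
elim: N => [|N IH].
  rewrite /zrange !big_seq1 subr0 add0r addrC subrK //.
rewrite !big_zrangeS -IH.
have -> : N.+1%:Z + 1 = N.+2%:Z :> int by lia.
have -> : - N.+1%:Z + 1 = - N%:Z :> int by lia.
ring.
Qed.

End SymmetricSums.

(** * Theta series: product formula and quasi-periodicity *)

Section ThetaSeries.
Variable R : realType.
Local Open Scope complex_scope.
Local Notation normc := (@ComplexField.Normc.normc R).

Lemma cexpD (x y : R[i]) : cexp (x + y) = cexp x * cexp y.
Proof.
case: x y => a b [c d]; rewrite /cexp /= expRD cosD sinD.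
by apply/eqP; rewrite eq_complex /=; apply/andP; split; apply/eqP; ring.
Qed.

Lemma normc_cexp (z : R[i]) : normc (cexp z) = expR (complex.Re z).
Proof.
rewrite /cexp ComplexField.Normc.normcM /= cos2Dsin2 sqrtr1 mulr1.
by rewrite expr0n addr0 sqrtr_sqr ger0_norm ?expR_ge0.
Qed.

Definition cexp2pi (z : R[i]) : R[i] := cexp (2%:R * pi%:C * 'i * z).

Lemma cexp2piD x y : cexp2pi (x + y) = cexp2pi x * cexp2pi y.
Proof. by rewrite /cexp2pi mulrDr cexpD. Qed.

Lemma cexp2piC (x : R) : cexp2pi x%:C = cos (2 * pi * x) +i* sin (2 * pi * x).
Proof.
have -> : cexp2pi x%:C = cexp (0 +i* (2 * pi * x)).
  congr cexp; apply/eqP; rewrite eq_complex /=.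
  by apply/andP; split; apply/eqP; ring.
by rewrite /cexp /= expR0 mul1r.
Qed.

Lemma cexp2pi0 : cexp2pi 0 = 1.
Proof. by rewrite -[0]/(0%:C) cexp2piC mulr0 cos0 sin0. Qed.

Lemma cexp2pi_half : cexp2pi (1 / 2)%:C = -1.
Proof.
rewrite cexp2piC (_ : 2 * pi * (1 / 2) = pi); last by field.
by rewrite cospi sinpi; apply/eqP; rewrite eq_complex /= oppr0 !eqxx.
Qed.

Lemma cexp2pi_int (n : int) : cexp2pi n%:~R = 1.
Proof.
have e1 : cexp2pi 1 = 1.
  have E : 1 = (1 / 2)%:C + (1 / 2)%:C :> R[i] by rewrite -rmorphD /= -splitr.
  by rewrite {1}E cexp2piD cexp2pi_half mulrNN mulr1.
have nat_case (k : nat) : cexp2pi k%:R = 1.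
  by elim: k => [|k IH]; rewrite ?cexp2pi0 // -natr1 cexp2piD IH e1 mulr1.
case: (intP n) => [|k|k]; rewrite ?cexp2pi0 //; first exact: nat_case.
rewrite -[LHS]mulr1 -{2}(nat_case k.+1) -cexp2piD rmorphN /= addNr.
exact: cexp2pi0.
Qed.

Lemma cexp2pi_neq0 z : cexp2pi z != 0.
Proof.
apply/eqP => z0; have := cexp2piD z (- z); rewrite z0 mul0r subrr cexp2pi0.
by apply/eqP; rewrite oner_eq0.
Qed.

(** The general term of the theta constant with characteristic [2a; 2b]; with halved
    characteristics, integral translations are the quasi-periods. *)
Definition theta_term (a b : R) (tau : R[i]) (n : int) : R[i] :=
  cexp2pi ((1 / 2)%:C * (n%:~R + a)%:C ^+ 2 * tau + (n%:~R + a)%:C * b%:C).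

Definition theta_series (a b : R) (tau : R[i]) : R[i] := zsum (theta_term a b tau).

Lemma theta_constE eps eps' tau :
  theta_const eps eps' tau = theta_series (eps / 2) (eps' / 2) tau :> R[i].
Proof.
rewrite /theta_const /theta_fun /theta_series; congr zsum.
by apply/funext => n; rewrite add0r.
Qed.

Lemma normc_theta_term a b tau n :
  normc (theta_term a b tau n) = expR (- (pi * complex.Im tau * (n%:~R + a) ^+ 2)).
Proof.
rewrite normc_cexp; congr expR; case: tau => x y; rewrite !expr2 /=.
by field.
Qed.

(* x ^ 2 >= 2 |x| - 1 bounds the Gaussian by a geometric sequence. *)
Lemma theta_term_dominated a b tau : 0 < complex.Im tau ->
  geom_dominated normc (theta_term a b tau).
Proof.
move=> y0; set y := complex.Im tau in y0 *.
have piy0 : 0 < pi * y by rewrite mulr_gt0 ?pi_gt0.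
exists (expR (pi * y * (1 + 2 * `|a|))), (expR (- (2 * (pi * y)))); split.
- exact: expR_ge0.
- by rewrite -expR0 ltr_expR oppr_lt0 mulr_gt0.
- move=> n; rewrite normc_theta_term -expRM_natl -expRD ler_expR.
  rewrite natr_absz intr_norm -subr_ge0.
  have -> : pi * y * (1 + 2 * `|a|) + `|n%:~R| * - (2 * (pi * y)) -
     - (pi * y * (n%:~R + a) ^+ 2) =
     pi * y * ((n%:~R + a) ^+ 2 + 1 + 2 * `|a| - 2 * `|n%:~R|) by ring.
  apply: mulr_ge0; first exact: ltW.
  have sq : 0 <= (`|n%:~R + a| - 1) ^+ 2 by apply: sqr_ge0.
  have sqn : `|n%:~R + a| ^+ 2 = (n%:~R + a) ^+ 2 by rewrite -normrX ger0_norm ?sqr_ge0.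
  have tri : `|n%:~R : R| <= `|n%:~R + a| + `|a|.
    by rewrite -{1}(addrK a n%:~R) (le_trans (ler_normB _ _)).
  by rewrite sqrrB sqn mulr1 expr1n -mulr_natl in sq; lra.
Qed.

(** With m = k + l and n = k - l, the squares of m + a + c and n + a - c add up to twice those of k
    + a and l + c, whence 2 tau; the linear parts separate likewise. For m = k + l + 1, both k and l
    are shifted by 1/2. *)
Lemma theta_series_mul a b c d tau : 0 < complex.Im tau ->
  theta_series (a + c) (b + d) tau * theta_series (a - c) (b - d) tau =
  theta_series a (2 * b) (2 * tau) * theta_series c (2 * d) (2 * tau) +
  theta_series (a + 1 / 2) (2 * b) (2 * tau) * theta_series (c + 1 / 2) (2 * d) (2 * tau).
Proof.
move=> tau0.
have tau20 : 0 < complex.Im (2 * tau).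
  by rewrite mulr_natl raddfMn /= pmulrn_lgt0.
apply: zsum_mul_diag; try exact: theta_term_dominated.
  move=> k l; rewrite /theta_term -!cexp2piD; congr cexp2pi.
  rewrite !(rmorphD, rmorphN, rmorphM, rmorph_int, rmorphXn, fmorphV, rmorph1) /=.
  by field.
move=> k l; rewrite /theta_term -!cexp2piD; congr cexp2pi.
rewrite !(rmorphD, rmorphN, rmorphM, rmorph_int, rmorphXn, fmorphV, rmorph1) /=.
by field.
Qed.

Lemma theta_seriesD1l a b tau : 0 < complex.Im tau ->
  theta_series (a + 1) b tau = theta_series a b tau.
Proof.
move=> tau0.
have E : theta_term (a + 1) b tau = fun n => theta_term a b tau (n + 1).
  by apply/funext => n; rewrite /theta_term intrD addrAC addrA.
rewrite /theta_series E; apply: zsum_shift; first exact: theta_term_dominated.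
by rewrite -E; apply: theta_term_dominated.
Qed.

Lemma theta_seriesD1r a b tau : 0 < complex.Im tau ->
  theta_series a (b + 1) tau = cexp2pi a%:C * theta_series a b tau.
Proof.
move=> tau0; rewrite /theta_series -zsumZ; last exact: theta_term_dominated.
congr zsum; apply/funext => n; rewrite /theta_term.
have -> : (b + 1)%:C = b%:C + 1 :> R[i] by rewrite rmorphD.
have enE : cexp2pi (n%:~R + a)%:C = cexp2pi a%:C.
  by rewrite rmorphD /= rmorph_int cexp2piD cexp2pi_int mul1r.
by rewrite mulrDr mulr1 addrA cexp2piD enE mulrC.
Qed.

Lemma theta_seriesN a b tau : theta_series (- a) (- b) tau = theta_series a b tau.
Proof.
rewrite /theta_series -zsum_opp; congr zsum; apply/funext => n.
by rewrite /theta_term rmorphN /= -opprD !rmorphN /= sqrrN mulrNN.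
Qed.

End ThetaSeries.

(** * Three-term relations at 5-torsion points *)

(** Once the units cancel, this is [0y][zw] = [0z][yw] - [0w][yz] for the 2 x 2 minors of four
    vectors (A, B). *)
Lemma scaled_pluecker (K : comPzRingType) (A0 B0 Ay By Az Bz Aw Bw ey ez ey' ez' : K) :
  ey' * ey = 1 -> ez' * ez = 1 ->
  ez' * (A0 * By - B0 * Ay) * (ez * (Az * Bw - Bz * Aw)) =
  ey' * (A0 * Bz - B0 * Az) * (ey * (Ay * Bw - By * Aw)) -
  ey' * (A0 * Bw - B0 * Aw) * (ey * (Ay * Bz - By * Az)).
Proof.
have cancel (x m n p : K) : x * n = 1 -> x * m * (n * p) = m * p.
  by move=> xn; rewrite mulrACA xn mul1r.
by move=> eyK ezK; rewrite !cancel //; ring.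
Qed.

Section ThreeTerm.
Variable R : realType.
Local Open Scope complex_scope.
Local Opaque theta_series cexp2pi.
Local Notation e := (@cexp2pi R).

(** Up to a nonvanishing exponential factor, this is the odd function $\theta[1;1]$ at the point u
    tau + v. *)
Definition theta_odd (u v : R) (tau : R[i]) : R[i] :=
  theta_series (1 / 2 + u) (1 / 2 + v) tau.

(** In the product formula the shift by 1/2 in both characteristics is absorbed by
    quasi-periodicity; e(1/2) = -1 then gives opposite signs to the two terms, which form a
    minor. *)
Lemma theta_odd_mul u v s t tau : 0 < complex.Im tau ->
  theta_odd (u + s) (v + t) tau * theta_odd (u - s) (v - t) tau =
  e u%:C * (theta_series u (2 * v) (2 * tau) * theta_series (s + 1 / 2) (2 * t) (2 * tau) -
            theta_series (u + 1 / 2) (2 * v) (2 * tau) * theta_series s (2 * t) (2 * tau)).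
Proof.
move=> tau0; have tau20 : 0 < complex.Im (2 * tau).
  by rewrite mulr_natl raddfMn /= pmulrn_lgt0.
rewrite /theta_odd !addrA theta_series_mul //.
have -> : 2 * (1 / 2 + v) = 2 * v + 1 by field.
have -> : 1 / 2 + u + 1 / 2 = u + 1 by field.
rewrite theta_seriesD1l // !theta_seriesD1r // (addrC (1 / 2) u).
have -> : e (u + 1 / 2)%:C = - e u%:C.
  by rewrite rmorphD cexp2piD cexp2pi_half mulrN1.
ring.
Qed.

(* By theta_odd_mul this is the Pluecker relation between 2 x 2 minors. *)
Lemma theta_odd_three_term (y1 y2 z1 z2 w1 w2 : R) tau : 0 < complex.Im tau ->
  e (- z1)%:C * (theta_odd y1 y2 tau * theta_odd (- y1) (- y2) tau) *
    (theta_odd (z1 + w1) (z2 + w2) tau * theta_odd (z1 - w1) (z2 - w2) tau) =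
  e (- y1)%:C * (theta_odd z1 z2 tau * theta_odd (- z1) (- z2) tau) *
    (theta_odd (y1 + w1) (y2 + w2) tau * theta_odd (y1 - w1) (y2 - w2) tau) -
  e (- y1)%:C * (theta_odd w1 w2 tau * theta_odd (- w1) (- w2) tau) *
    (theta_odd (y1 + z1) (y2 + z2) tau * theta_odd (y1 - z1) (y2 - z2) tau).
Proof.
move=> tau0.
have mul0 u v : theta_odd u v tau * theta_odd (- u) (- v) tau =
    theta_series 0 0 (2 * tau) * theta_series (u + 1 / 2) (2 * v) (2 * tau) -
    theta_series (0 + 1 / 2) 0 (2 * tau) * theta_series u (2 * v) (2 * tau).
  have := theta_odd_mul 0 0 u v tau0.
  by rewrite !add0r !mulr0 cexp2pi0 mul1r.
have eN (u : R) : e (- u)%:C * e u%:C = 1.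
  by rewrite -cexp2piD rmorphN /= addNr cexp2pi0.
rewrite (mul0 y1 y2) (mul0 z1 z2) (mul0 w1 w2) (theta_odd_mul z1 z2 w1 w2 tau0).
rewrite (theta_odd_mul y1 y2 w1 w2 tau0) (theta_odd_mul y1 y2 z1 z2 tau0).
exact: scaled_pluecker.
Qed.

(** Nonzero constant factors can be absorbed in the coefficients of [reducible]. *)
Definition proportional (f h : R[i] -> R[i]) : Prop :=
  exists2 c, c != 0 & forall tau, upper_half_plane tau -> f tau = c * h tau.

Lemma proportional_trans f h k :
  proportional f h -> proportional h k -> proportional f k.
Proof.
move=> [c c0 fh] [d d0 hk]; exists (c * d); first by rewrite mulf_neq0.
by move=> tau tau0; rewrite fh // hk // mulrA.
Qed.

Lemma theta_seriesDz a b (n k : int) :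
  proportional (theta_series (a + n%:~R) (b + k%:~R)) (@theta_series R a b).
Proof.
have natl (m : nat) x y tau : 0 < complex.Im tau ->
    theta_series (x + m%:R) y tau = theta_series x y tau :> R[i].
  move=> tau0; elim: m => [|m IH]; first by rewrite addr0.
  by rewrite -natr1 addrA theta_seriesD1l.
have natr (m : nat) x y tau : 0 < complex.Im tau ->
    theta_series x (y + m%:R) tau = e x%:C ^+ m * theta_series x y tau :> R[i].
  move=> tau0; elim: m => [|m IH]; first by rewrite addr0 mul1r.
  by rewrite -natr1 addrA theta_seriesD1r // IH exprS mulrA.
have ez m x : e x ^+ m != 0 by rewrite expf_neq0 // cexp2pi_neq0.
apply: (@proportional_trans _ (theta_series a (b + k%:~R))).
  exists 1; first exact: oner_neq0.
  move=> tau tau0; rewrite mul1r; case: (intP n) => [|m|m]; first by rewrite addr0.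
    exact: natl.
  by rewrite -[LHS](natl m.+1) // rmorphN /= subrK.
case: (intP k) => [|m|m].
- by exists 1; [exact: oner_neq0 | move=> tau _; rewrite addr0 mul1r].
- by exists (e a%:C ^+ m.+1) => // tau tau0; apply: natr.
- exists (e a%:C ^+ m.+1)^-1; first by rewrite invr_neq0.
  move=> tau tau0; rewrite -{2}(subrK m.+1%:R b) natr // mulKf //.
Qed.

Definition theta_five (p : int * int) : R[i] -> R[i] :=
  theta_odd (p.1%:~R / 5) (p.2%:~R / 5).

Lemma theta_five_period (p q : int * int) :
  proportional (theta_five (p.1 + 5 * q.1, p.2 + 5 * q.2)) (theta_five p).
Proof.
rewrite /theta_five /theta_odd /=.
have shift (x y : int) : 1 / 2 + (x + 5 * y)%:~R / 5 = 1 / 2 + x%:~R / 5 + y%:~R :> R.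
  by rewrite intrD intrM; field.
by rewrite !shift; apply: theta_seriesDz.
Qed.

(** The characteristic 1/2 - x is the negative of 1/2 + x, shifted by 1. *)
Lemma theta_five_opp (p : int * int) :
  proportional (theta_five (- p.1, - p.2)) (theta_five p).
Proof.
have -> : theta_five p = theta_series (- (1 / 2 + p.1%:~R / 5)) (- (1 / 2 + p.2%:~R / 5)).
  by apply/funext => tau; rewrite theta_seriesN.
rewrite /theta_five /theta_odd /=.
have shift (x : int) : 1 / 2 + (- x)%:~R / 5 = - (1 / 2 + x%:~R / 5) + 1%:~R :> R.
  by rewrite rmorphN /=; field.
by rewrite !shift; apply: theta_seriesDz.
Qed.

(** Equality of 5-torsion points up to sign, in a form decidable by computation. *)
Definition congr5 (p q : int * int) : bool :=
  (p.1 - q.1 \in dvdz 5) && (p.2 - q.2 \in dvdz 5) ||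
  (p.1 + q.1 \in dvdz 5) && (p.2 + q.2 \in dvdz 5).

Lemma theta_five_congr p q : congr5 p q -> proportional (theta_five p) (theta_five q).
Proof.
case: p q => [p1 p2] [q1 q2].
have dvd (x y : int) : x - y \in dvdz 5 -> exists k, x = y + 5 * k.
  by move=> /(@dvdzP 5 (x - y))[k xy]; exists k; rewrite mulrC -xy addrC subrK.
rewrite /congr5 /= => /orP[] /andP[].
  move=> /dvd[k ->] /dvd[l ->].
  exact: (theta_five_period (q1, q2) (k, l)).
rewrite -{1}(opprK q1) -{1}(opprK q2) => /dvd[k ->] /dvd[l ->].
apply: proportional_trans (theta_five_opp (q1, q2)).
exact: (theta_five_period (- q1, - q2) (k, l)).
Qed.

(** The domain is a subtype because [reducible] asks for identities at every point of [T]. *)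
Definition theta_five_H (x : nat -> int * int) n (i : 'I_n)
  (t : {tau : R[i] | upper_half_plane tau}) : R[i] := theta_five (x i) (sval t).

(** The three-term relation at [y], [z], [w] is solved for its first product. The variables [q1] to
    [q6] represent the sums and differences up to sign, and the weight bounds make that product the
    leading one. *)
Lemma theta_five_reducible (x : nat -> int * int) n (wt : 'I_n -> nat)
  (y z w q1 q2 q3 q4 q5 q6 : 'I_n) :
  let add (i j : 'I_n) := ((x i).1 + (x j).1, (x i).2 + (x j).2) in
  let sub (i j : 'I_n) := ((x i).1 - (x j).1, (x i).2 - (x j).2) in
  congr5 (add z w) (x q1) -> congr5 (sub z w) (x q2) ->
  congr5 (add y w) (x q3) -> congr5 (sub y w) (x q4) ->
  congr5 (add y z) (x q5) -> congr5 (sub y z) (x q6) ->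
  (wt z + wt z + wt q3 + wt q4 < wt y + wt y + wt q1 + wt q2)%N ->
  (wt w + wt w + wt q5 + wt q6 < wt y + wt y + wt q1 + wt q2)%N ->
  reducible (theta_five_H x (n := n)) wt (U_(y) + U_(y) + U_(q1) + U_(q2))%MM.
Proof.
move=> add sub /theta_five_congr[c1 c1n h1] /theta_five_congr[c2 c2n h2].
move=> /theta_five_congr[c3 _ h3] /theta_five_congr[c4 _ h4].
move=> /theta_five_congr[c5 _ h5] /theta_five_congr[c6 _ h6] wz ww.
have [cy cyn hy] := theta_five_opp (x y); have [cz _ hz] := theta_five_opp (x z).
have [cw _ hw] := theta_five_opp (x w).
pose ey := e (- ((x y).1%:~R / 5))%:C; pose ez := e (- ((x z).1%:~R / 5))%:C.
have ezn : ez != 0 by apply: cexp2pi_neq0.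
(* Here [cy], [cz], [cw] come from passing to opposite points and [c1] to [c6] from the congruences;
   the denominator is the coefficient of the leading product. *)
exists (ey * cz * c3 * c4 / (ez * cy * c1 * c2)).
exists (- (ey * cw * c5 * c6 / (ez * cy * c1 * c2))).
exists (U_(z) + U_(z) + U_(q3) + U_(q4))%MM, (U_(w) + U_(w) + U_(q5) + U_(q6))%MM.
split; rewrite ?mdegD ?mdeg1 ?mweightD ?mweightU // => -[tau tau0].
rewrite !monom_evalD !monom_evalU /theta_five_H /=.
have := theta_odd_three_term ((x y).1%:~R / 5) ((x y).2%:~R / 5)
  ((x z).1%:~R / 5) ((x z).2%:~R / 5) ((x w).1%:~R / 5) ((x w).2%:~R / 5) tau0.
have D (a b : int) : a%:~R / 5 + b%:~R / 5 = (a + b)%:~R / 5 :> R.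
  by rewrite intrD mulrDl.
have B (a b : int) : a%:~R / 5 - b%:~R / 5 = (a - b)%:~R / 5 :> R.
  by rewrite rmorphB /= mulrBl.
have N (a : int) : - (a%:~R / 5) = (- a)%:~R / 5 :> R by rewrite rmorphN mulNr.
rewrite -/ey -/ez !D !B !N.
have E (a b : int) : theta_odd (a%:~R / 5) (b%:~R / 5) tau = theta_five (a, b) tau by [].
rewrite !E h1 // h2 // h3 // h4 // h5 // h6 // hy // hz // hw //.
rewrite -!surjective_pairing.
set gy := theta_five (x y) _; set gz := theta_five (x z) _.
set gw := theta_five (x w) _; set g1 := theta_five (x q1) _.
set g2 := theta_five (x q2) _; set g3 := theta_five (x q3) _.
set g4 := theta_five (x q4) _; set g5 := theta_five (x q5) _.
set g6 := theta_five (x q6) _ => rel.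
clearbody ey ez gy gz gw g1 g2 g3 g4 g5 g6.
apply: (@mulfI _ (ez * cy * c1 * c2)); first by do 3![apply: mulf_neq0 => //].
have -> : ez * cy * c1 * c2 * (gy * gy * g1 * g2) =
  ez * (gy * (cy * gy)) * (c1 * g1 * (c2 * g2)) by ring.
rewrite rel; field.
by rewrite ezn cyn c1n c2n.
Qed.

End ThreeTerm.

(** * The twelve characteristics and the finite verification *)

(* Index k < 10 is the characteristic [j/5; l/5] with j = 1 + 2 (k / 5) and
   l = 1 + 2 (k mod 5); indices 10 and 11 are [1; 1/5] and [1; 3/5]. *)
Definition char_point (k : nat) : int * int :=
  if (k < 10)%N then ((k %/ 5)%N%:Z - 2, (k %% 5)%N%:Z - 2) else (0, k%:Z - 12).

(* The weights and classes were found by a computer search over the three-term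
   relations: inside each class, any two variables x, y occur in a relation
   whose term of largest weight is x ^ 3 y or x y ^ 3. *)
Definition char_weight (i : 'I_12) : nat :=
  nth 0%N [:: 1; 3; 2; 2; 2; 1; 4; 0; 0; 0; 4; 0]%N i.

Definition char_class (i : 'I_12) : 'I_5 :=
  inZp (nth 0 [:: 0; 3; 4; 2; 1; 1; 4; 3; 4; 2; 3; 0] i)%N.

(** For each of the nine pairs inside a class, the points of the chosen relation; [y] is the
    variable that occurs cubed. The default is never reached by such a pair. *)
Definition char_triple (i j : nat) : 'I_12 * 'I_12 * 'I_12 :=
  let: (y, z, w) := match i, j with
    | 0, 11 => (0, 8, 9) | 4, 5 => (4, 0, 7) | 3, 9 => (3, 0, 8)
    | 1, 7 => (1, 0, 5) | 1, 10 => (10, 5, 8) | 7, 10 => (10, 1, 3)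
    | 2, 6 => (2, 4, 5) | 2, 8 => (2, 0, 9) | 6, 8 => (6, 7, 11)
    | _, _ => (0, 0, 0)
  end%N in (inZp y, inZp z, inZp w).

(** If no representative exists, [find] returns 12, which wraps to 0; the test [ok] in
    [char_leading] rejects this case. *)
Definition char_index (p : int * int) : 'I_12 :=
  inZp (find (fun k => congr5 p (char_point k)) (iota 0 12)).

Definition char_leading (i j : 'I_12) : bool :=
  let: (y, z, w) := char_triple i j in
  let add (a b : 'I_12) := ((char_point a).1 + (char_point b).1,
                            (char_point a).2 + (char_point b).2) in
  let sub (a b : 'I_12) := ((char_point a).1 - (char_point b).1,
                            (char_point a).2 - (char_point b).2) in
  let ok p := congr5 p (char_point (char_index p)) in
  let q1 := char_index (add z w) in let q2 := char_index (sub z w) in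
  let q3 := char_index (add y w) in let q4 := char_index (sub y w) in
  let q5 := char_index (add y z) in let q6 := char_index (sub y z) in
  let wt := char_weight in
  [&& all ok [:: add z w; sub z w; add y w; sub y w; add y z; sub y z],
      (wt z + wt z + wt q3 + wt q4 < wt y + wt y + wt q1 + wt q2)%N,
      (wt w + wt w + wt q5 + wt q6 < wt y + wt y + wt q1 + wt q2)%N &
      perm_eq [:: y; y; q1; q2] [:: i; i; i; j] ||
      perm_eq [:: y; y; q1; q2] [:: j; j; j; i]].

(** The check runs over natural numbers, where it evaluates, and is carried to ordinals by
    [valZpK]. *)
Lemma char_class_leading (i j : 'I_12) :
  (i < j)%N -> char_class i = char_class j -> char_leading i j.
Proof.
have ok : all (fun a => all (fun b => (a < b)%N ==>
    (char_class (inZp a) == char_class (inZp b)) ==>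
    char_leading (inZp a) (inZp b)) (iota 0 12)) (iota 0 12) by vm_compute.
move=> ij cij; move/allP/(_ i): ok; rewrite mem_iota add0n ltn_ord => /(_ isT).
move/allP/(_ j); rewrite mem_iota add0n ltn_ord => /(_ isT).
by rewrite ij !valZpK cij eqxx.
Qed.

(** Whichever of x ^ 3 y and x y ^ 3 is the leading term, it divides x ^ 3 y ^ 3; hence the exponent
    3 for both variables. *)
Lemma char_class_reducible (R : realType) (i j : 'I_12) :
  (i < j)%N -> char_class i = char_class j ->
  reducible (theta_five_H (R := R) char_point (n := 12)) char_weight
    (U_(i) *+ 3 + U_(j) *+ 3)%MM.
Proof.
move=> ij cij; have := char_class_leading ij cij; rewrite /char_leading.
case: (char_triple i j) => [[y z] w]; cbv zeta.
case/and4P => /and4P[h1 h2 h3 /and4P[h4 h5 h6 _]] wz ww lead.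
have red := @theta_five_reducible R char_point 12 char_weight y z w _ _ _ _ _ _
  h1 h2 h3 h4 h5 h6 wz ww.
have sumE a b c d : (U_(a) + U_(b) + U_(c) + U_(d))%MM =
    (\sum_(k <- [:: a; b; c; d]) U_(k : 'I_12))%MM.
  by rewrite !big_cons big_nil addm0 !addmA.
move: red; rewrite sumE.
case/orP: lead => /(perm_big _) ->; rewrite -sumE.
  have -> : (U_(i) *+ 3 + U_(j) *+ 3 = U_(i) + U_(i) + U_(i) + U_(j) + (U_(j) + U_(j)))%MM.
    by apply/mnmP => k; rewrite !(mnmDE, mulmnE); ring.
  exact: reducibleD.
have -> : (U_(i) *+ 3 + U_(j) *+ 3 = U_(j) + U_(j) + U_(j) + U_(i) + (U_(i) + U_(i)))%MM.
  by apply/mnmP => k; rewrite !(mnmDE, mulmnE); ring.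
exact: reducibleD.
Qed.

Ltac eval_char_point :=
  match goal with |- context [char_point ?k] =>
    let p := eval vm_compute in (char_point k) in change (char_point k) with p
  end.

Lemma twelve_char_theta_five (R : realType) (eps eps' : R) : twelve_char eps eps' ->
  exists k : 'I_12, theta_const eps eps' = theta_five (char_point k).
Proof.
have point (k : 'I_12) :
    eps / 2 = 1 / 2 + (char_point k).1%:~R / 5 ->
    eps' / 2 = 1 / 2 + (char_point k).2%:~R / 5 ->
    exists k : 'I_12, theta_const eps eps' = theta_five (char_point k).
  move=> h1 h2; exists k; apply/funext => tau; by rewrite theta_constE h1 h2.
case=> [[j [k [jP [kP [epsE epsE']]]]] | [j [jP [epsE epsE']]]].
  (* An odd number 1 + 2 r satisfies (1 + 2 r) / 10 = 1/2 + (r - 2) / 5, and halving recovers r. *)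
  apply: (point (inZp (j./2 * 5 + k./2))); rewrite ?epsE ?epsE' {epsE epsE' point};
  move: jP kP; rewrite !inE => /orP[] /eqP-> /or4P[/eqP->|/eqP->|/eqP->|/orP[]/eqP->];
  eval_char_point; rewrite /= ?NegzE; lra.
apply: (point (inZp (10 + j./2))); rewrite ?epsE ?epsE' {epsE epsE' point};
move: jP; rewrite !inE => /orP[] /eqP->; eval_char_point; rewrite /= ?NegzE; lra.
Qed.

Unset Implicit Arguments.

(* "At most five of the twelve theta constants are algebraically independent":
   any six of them (chosen among the twelve) are algebraically dependent. *)
Theorem theorem8p2 (R : realType) (eps eps' : 'I_6 -> R) :
  (forall i : 'I_6, twelve_char (eps i) (eps' i)) ->
  alg_dependent_on_H (fun i : 'I_6 => theta_const (eps i) (eps' i)).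
Proof.
move=> /(fun h i => twelve_char_theta_five (h i))/fin_all_exists[s sE].
(* Twelve variables in five classes with b = 3: any 5 + 1 of them are dependent. *)
have [P P0 Pz] := algebraic_dependence (@char_class_reducible R) s.
exists P; split => // tau tau0; rewrite -[RHS](Pz (exist _ tau tau0)).
by apply: meval_eq => i; rewrite sE.
Qed.
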